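(* For any natural number $n\ge 1$ there exist a real number $\alpha_n>0$ and a function $g_n\colon[0,\alpha_n)\to\mathbf{R}$ such that (1) $g_n$ is matrix monotone of order $n$ on $[0,\alpha_n)$; (2) $g_n$ is not matrix monotone of order $n+1$ on $[0,\alpha_n)$, nor is (the restriction of) $g_n$ matrix monotone of order $n+1$ on any non-trivial subinterval of $[0,\alpha_n)$.
   Context: Let $I\subseteq\mathbf{R}$ be a non-trivial interval (i.e. containing more than one point). A real, continuous function $f\colon I\to\mathbf{R}$ is called matrix monotone of order $n$ on $I$ if for every pair of self-adjoint complex $n\times n$ matrices $x,y$ with eigenvalues in $I$, $x\le y$ implies $f(x)\le f(y)$. Here $f(x)$ is defined by functional calculus and $x\le y$ means that $y-x$ is positive semi-definite. *)

(* Defs.v *)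
From HB Require Import structures.
From mathcomp Require Import all_boot all_order all_algebra.
From mathcomp Require Import sesquilinear spectral.
From mathcomp Require Import complex.
From mathcomp Require Import all_classical all_reals all_analysis.

Set Implicit Arguments.
Unset Strict Implicit.
Unset Printing Implicit Defensive.

Import Order.TTheory GRing.Theory Num.Theory.
Import numFieldNormedType.Exports.
Local Open Scope classical_set_scope.
Local Open Scope ring_scope.
Local Open Scope sesquilinear_scope.
Local Open Scope complex_scope.

Definition nontrivial_interval (R : realType) (I : set R) : Prop :=
  is_interval I /\ exists x y : R, [/\ I x, I y & x <> y].

(* Functional calculus f(x) of a self-adjoint x = P^-1 diag(d) P, where P is
   unitary and d is real: f(x) := P^-1 diag(f(d)) P. Only the values of f on the
   spectrum of x matter, and funcalcE below shows that the result does not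
   depend on the diagonalization chosen by the library. On non-normal matrices
   the value is meaningless. *)
Definition funcalc (R : realType) (f : R -> R) (n : nat) (x : 'M[R[i]]_n) :
    'M[R[i]]_n :=
  let P := spectralmx x in
  invmx P *m
  diag_mx (map_mx (fun z : R[i] => (f (complex.Re z))%:C) (spectral_diag x)) *m
  P.

(* In R[i], 0 <= z means that z is real and non-negative. *)
Definition psdmx (R : realType) (n : nat) (x : 'M[R[i]]_n) : Prop :=
  x \is hermsymmx /\ forall v : 'cV[R[i]]_n, 0 <= (v ^t* *m x *m v) 0 0.

Definition loewner_le (R : realType) (n : nat) (x y : 'M[R[i]]_n) : Prop :=
  psdmx (y - x).

Definition eigenvalues_in (R : realType) (I : set R) (n : nat)
    (x : 'M[R[i]]_n) : Prop :=
  forall a : R[i], eigenvalue x a -> exists2 r : R, I r & a = r%:C.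

(* A function I -> R is represented by a total function f : R -> R; only the
   values of f on I are relevant, so that the restriction of f to a subset J
   of I is obtained by replacing I with J. *)
Definition matrix_monotone (R : realType) (n : nat) (I : set R) (f : R -> R) :
    Prop :=
  {within I, continuous f} /\
  forall x y : 'M[R[i]]_n,
    x \is hermsymmx -> y \is hermsymmx ->
    eigenvalues_in I x -> eigenvalues_in I y ->
    loewner_le x y -> loewner_le (funcalc f x) (funcalc f y).

Lemma funcalcE (R : realType) (f : R -> R) (n : nat) (P : 'M[R[i]]_n)
    (d : 'rV[R[i]]_n) :
  P \is unitarymx ->
  funcalc f (invmx P *m diag_mx d *m P) =
  invmx P *m diag_mx (map_mx (fun z : R[i] => (f (complex.Re z))%:C) d) *m P.
Proof.
move=> Pu; set x := invmx P *m _ *m _; rewrite /funcalc.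
have /orthomx_spectralP : x \is normalmx.
  by apply/orthomx_spectral_subproof; exists (P, d).
have := spectral_unit x; move: (spectralmx x) (spectral_diag x) => Q e Qu /= xE.
have {}Pu := unitarymx_unit Pu.
pose U := Q *m invmx P.
have UE : U *m diag_mx d = diag_mx e *m U.
  have : Q *m x *m invmx P = Q *m x *m invmx P by [].
  by rewrite {1}/x {1}xE !mulmxA mulmxK // mulmxV // mul1mx -!mulmxA.
set g := fun z : R[i] => _.
have gUE : U *m diag_mx (map_mx g d) = diag_mx (map_mx g e) *m U.
  apply/matrixP => i j; have /matrixP/(_ i j) := UE.
  rewrite mul_mx_diag mul_diag_mx mul_mx_diag mul_diag_mx !mxE.
  rewrite [RHS]mulrC => /eqP; rewrite -subr_eq0 -mulrBr mulf_eq0 subr_eq0.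
  by case/orP => [/eqP ->|/eqP ->]; rewrite ?mul0r ?mulr0 // mulrC.
have /(congr1 (fun A => invmx Q *m A *m P)) := gUE.
by rewrite /U !mulmxA mulVmx // mul1mx mulmxKV.
Qed.

(* Main.v *)
Require Import Defs.
From mathcomp Require Import all_boot all_order all_algebra.
From mathcomp Require Import sesquilinear spectral complex polyrcf.
From mathcomp Require Import all_classical all_reals all_analysis.
From mathcomp Require Import zify ring.

(** Let [g(t) = a_0 t + a_1 t^2 + ... + a_(N-1) t^N] with [N = 2n] and all
    [a_k > 0].  Along a segment [x + t h], with [h = U U^*], the derivative of
    [w^* g(x + t h) w] is a sum, over the columns [u] of [U], of the truncated
    Hankel forms
      [sum_(i + j < N) a_(i+j) c_i (c_j)^*],  [c_i = w^* (x + t h)^i u]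
    ([hankel_form_gram]).  Both halves of the theorem are read off this form.

    Order [n].  The [c_i] are power sums [sum_l d_l^i b_l] over the [n]
    eigenvalues [d_l].  Dividing [X^i] by the characteristic polynomial, whose
    lower coefficients are small when the eigenvalues are, bounds [c_i] for
    [i >= n] by a small multiple of [c_0, ..., c_(n-1)] ([power_sum_tail_le]).
    So the form is a small perturbation of its [n] by [n] corner
    [(a_(i+j))_(i,j<n)], and it is nonnegative as soon as that corner is
    positive definite.  With [a_k = B^(k^2)] and [d_i = B^(2 i^2) c_i] the
    corner becomes [sum B^(-(i-j)^2) d_i (d_j)^*], which for large [B] is
    diagonally dominant ([hankel_form_Re_ge0]).  Hence [w^* g(x + t h) w] is
    nondecreasing whenever the spectra lie in a short interval [[0, alpha)].

    Order [n+1].  On [n+1] distinct points a Vandermonde system prescribes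
    [c_0, ..., c_n] freely.  When [c_i = 0] for [i < n-1] the truncation
    [i + j < N] leaves only the positions [(n-1, n-1)], [(n-1, n)] and
    [(n, n-1)] ([hankel_form_two_terms]), and as the entry [(n, n)] is missing
    the cross terms can be made negative and outweigh the diagonal one.  The
    points can be taken in any nontrivial interval ([gap_fun_not_monotone]). *)

Set Implicit Arguments.
Unset Strict Implicit.
Unset Printing Implicit Defensive.

Import Order.TTheory GRing.Theory Num.Theory.
Import numFieldNormedType.Exports.
Local Open Scope classical_set_scope.
Local Open Scope ring_scope.
Local Open Scope sesquilinear_scope.
Local Open Scope complex_scope.

(** * Power sums of small numbers *)

(** Each factor [X - z] at most doubles the coefficients, and every coefficient
    below the leading one has picked up at least one small root. *)
Lemma coef_prod_XsubC_le (C : numDomainType) (a : C) (s : seq C) :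
    0 <= a <= 1 -> {in s, forall z, `|z| <= a} ->
  let p := \prod_(z <- s) ('X - z%:P) in
  (forall j, `|p`_j| <= 2 ^+ size s) /\
  (forall j, (j < size s)%N -> `|p`_j| <= a * 2 ^+ size s).
Proof.
move=> /andP[a_ge0 a_le1]; elim: s => [|z s IHs] s_le /=.
  rewrite big_nil; split=> // j; rewrite coef1 expr0.
  by case: (j == 0)%N; rewrite ?normr1 ?normr0.
have [| le2 lea] := IHs; first by move=> y ys; apply: s_le; rewrite inE ys orbT.
have z_le : `|z| <= a by apply: s_le; rewrite inE eqxx.
rewrite big_cons; set p := \prod_(_ <- s) _ in le2 lea *.
have cE j : (('X - z%:P) * p)`_j =
    (if j is j'.+1 then p`_j' else 0) - z * p`_j.
  by rewrite mulrBl coefB coefXM coefCM; case: j.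
have zp j : `|z * p`_j| <= a * 2 ^+ size s.
  by rewrite normrM ler_pM.
have a2 : a * 2 ^+ size s <= 2 ^+ size s by rewrite ler_piMl ?exprn_ge0.
have dbl (x : C) : x * 2 ^+ (size s).+1 = x * 2 ^+ size s + x * 2 ^+ size s.
  by rewrite exprS; ring.
split=> j; rewrite cE.
  rewrite -[leRHS]mul1r dbl !mul1r.
  apply: le_trans (ler_normB _ _) (lerD _ (le_trans (zp _) a2)).
  by case: j => [|j]; rewrite ?normr0 ?exprn_ge0.
move=> j_lt; rewrite dbl.
apply: le_trans (ler_normB _ _) (lerD _ (zp _)).
by case: j j_lt => [|j j_lt]; rewrite ?normr0 ?mulr_ge0 ?exprn_ge0 ?lea.
Qed.

(** The [d m] are roots of a monic polynomial of degree [n] with small lower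
    coefficients, so the sequence [c] satisfies a linear recurrence of order [n]
    with small coefficients. *)
Lemma power_sum_tail_le (C : numDomainType) (n : nat) (d b : 'I_n -> C)
    (a M : C) (c := fun k : nat => \sum_m d m ^+ k * b m) :
    (0 < n)%N -> 0 <= a -> n%:R * 2 ^+ n * a <= 1 ->
    (forall m, `|d m| <= a) ->
    (forall k, (k < n)%N -> `|c k| <= M) ->
  forall k, (n <= k)%N -> `|c k| <= n%:R * 2 ^+ n * a * M.
Proof.
move=> n_gt0 a_ge0 Ka_le1 d_le c_le.
have n_ge1 : 1 <= n%:R :> C by rewrite ler1n.
have two_ge1 : 1 <= 2 ^+ n :> C by rewrite exprn_ege1 ?ler1n.
have M_ge0 : 0 <= M by apply: le_trans (c_le 0%N n_gt0).
have a_le1 : a <= 1.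
  apply: le_trans Ka_le1; rewrite ler_peMl // -[leLHS]mulr1 ler_pM //.
have KM_leM : n%:R * 2 ^+ n * a * M <= M by rewrite ler_piMl.
pose s := [seq d m | m <- enum 'I_n].
have size_s : size s = n by rewrite size_map size_enum_ord.
have [|z|_] := @coef_prod_XsubC_le C a s; first by rewrite a_ge0.
  by case/mapP=> m _ ->; apply: d_le.
set p := \prod_(z <- s) _; rewrite size_s => p_le.
have p_size : size p = n.+1 by rewrite size_prod_XsubC size_s.
have p_lead : p`_n = 1.
  by have /monicP := monic_prod_XsubC s predT id; rewrite lead_coefE p_size.
(* p vanishes at each d m, whence the recurrence. *)
have rec t : \sum_(j < n.+1) p`_j * c (j + t)%N = 0.
  transitivity (\sum_m p.[d m] * (d m ^+ t * b m)).
    under eq_bigr do rewrite mulr_sumr.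
    rewrite exchange_big /=; apply: eq_bigr => m _.
    rewrite horner_coef p_size mulr_suml; apply: eq_bigr => j _.
    by rewrite exprD !mulrA.
  rewrite big1 // => m _; suff /rootP->: root p (d m) by rewrite mul0r.
  by rewrite root_prod_XsubC map_f ?mem_enum.
move=> k; elim/ltn_ind: k => k IHk n_le_k.
have /eqP := rec (k - n)%N; rewrite big_ord_recr /= p_lead mul1r subnKC //.
rewrite addrC addr_eq0 => /eqP->; rewrite normrN.
apply: le_trans (ler_norm_sum _ _ _) _.
have -> : n%:R * 2 ^+ n * a * M = \sum_(j < n) a * 2 ^+ n * M.
  by rewrite sumr_const card_ord -mulr_natl; ring.
apply: ler_sum => j _; rewrite normrM ler_pM ?p_le //.
have [lt_n|ge_n] := ltnP (j + (k - n)) n; first exact: c_le.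
by apply: le_trans KM_leM; apply: IHk => //; have := ltn_ord j; lia.
Qed.

(** The matrix of this linear system is a Vandermonde matrix. *)
Lemma power_sums_prescribed (C : fieldType) n (t : 'I_n -> C) (b : nat -> C) : injective t ->
  exists u : 'I_n -> C, forall i, (i < n)%N -> \sum_l t l ^+ i * u l = b i.
Proof.
move=> t_inj; pose V := Vandermonde n (\row_l t l).
have Vu : V \in unitmx.
  rewrite unitmxE det_Vandermonde unitfE; apply/prodf_neq0 => i _.
  apply/prodf_neq0 => j ij; rewrite !mxE subr_eq0; apply/eqP => /t_inj ji.
  by rewrite ji ltnn in ij.
exists (fun l => (invmx V *m (\col_i b (nat_of_ord i))) l 0) => i i_lt.
have := mulKVmx Vu (\col_(i < n) b i).
move=> /matrixP/(_ (Ordinal i_lt) 0); rewrite !mxE /= => <-.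
by apply: eq_bigr => l _; rewrite !mxE.
Qed.

(** * Truncated Hankel forms *)

(** The sum of [a (i + j) * c i * (c j)^*] over [i + j < N], grouped by [i + j] as
    it arises from differentiating powers. *)
Definition hankel_form (C : numClosedFieldType) (a : nat -> C) (N : nat)
    (c : nat -> C) : C :=
  \sum_(k < N) a k * \sum_(i < k.+1) c i * (c (k - i)%N)^*.

Lemma sum_double_diag (C : nmodType) (n : nat) (F : nat -> C) :
  \sum_(k < n.*2) \sum_(i < k.+1) (if k == i.*2 :> nat then F i else 0) =
  \sum_(i < n) F i.
Proof.
elim: n => [|n IHn]; first by rewrite !big_ord0.
rewrite doubleS big_ord_recr big_ord_recr /= IHn [RHS]big_ord_recr /= -addrA.
congr (_ + _).
rewrite [X in _ + X]big1 => [|i _]; last by case: eqP => //; lia.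
have n_lt : (n < n.*2.+1)%N by lia.
rewrite addr0 (bigD1 (Ordinal n_lt)) //= eqxx big1 ?addr0 // => i.
by rewrite -val_eqE /= => /eqP i_ne; case: eqP => //; lia.
Qed.

(** In terms of [d i = B ^ (2 i^2) c i] the diagonal entries with [i < n]
    contribute exactly [D], the squared norm of [d].  There are at most [N^2 = B]
    other entries and each is at most [D / B]: when [i] and [j] are both below
    [n], because [(i + j)^2 + 1 <= 2 i^2 + 2 j^2] for [i != j]; otherwise because
    the factor with the large index is small by hypothesis. *)
Lemma hankel_form_Re_ge0 (C : numClosedFieldType) (n : nat) (c : nat -> C)
    (e : C) (N := n.*2) (B : C := (N ^ 2)%:R)
    (D := \sum_(i < n) `|B ^+ (2 * i ^ 2) * c i| ^+ 2) :
    (0 < n)%N -> 0 <= e -> B ^+ (N ^ 2).+1 * e <= 1 ->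
    (forall M, (forall k, (k < n)%N -> `|c k| <= M) ->
      forall k, (n <= k)%N -> `|c k| <= e * M) ->
  0 <= 'Re (hankel_form (fun k => B ^+ (k ^ 2)) N c).
Proof.
move=> n_gt0 e_ge0 e_small tail.
pose M := sqrtC D.
have D_ge0 : 0 <= D by apply: sumr_ge0 => i _; rewrite exprn_ge0.
have M2 : M ^+ 2 = D by rewrite sqrtCK.
have M_ge0 : 0 <= M by rewrite sqrtC_ge0.
have B_ge1 : 1 <= B by rewrite ler1n; lia.
have B_gt0 : 0 < B by apply: lt_le_trans ltr01 B_ge1.
have d_le i : (i < n)%N -> B ^+ (2 * i ^ 2) * `|c i| <= M.
  move=> i_lt; rewrite -(@ler_pXn2r _ 2) ?nnegrE ?mulr_ge0 ?exprn_ge0 ?(ltW B_gt0) //.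
  rewrite M2 /D (bigD1 (Ordinal i_lt)) //= normrM.
  rewrite (ger0_norm (exprn_ge0 _ (ltW B_gt0))).
  by rewrite lerDl sumr_ge0 // => j _; rewrite exprn_ge0.
have c_le i : (i < n)%N -> `|c i| <= M.
  by move/d_le; apply: le_trans; rewrite ler_peMl // exprn_ege1.
have tail_le k : (n <= k)%N -> `|c k| <= e * M by apply: tail.
(* i + j < 2n leaves no room for two large indices. *)
have far_le i j : (n <= i)%N -> (i + j < N)%N ->
    B ^+ ((i + j) ^ 2).+1 * (`|c i| * `|c j|) <= D.
  move=> n_le ij_lt; have j_lt : (j < n)%N by lia.
  apply: le_trans (_ : B ^+ (N ^ 2).+1 * (e * M * M) <= _).
    apply: ler_pM; rewrite ?mulr_ge0 ?exprn_ge0 ?(ltW B_gt0) //.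
      by apply: ler_weXn2l => //; rewrite ltnS leq_exp2r // ltnW.
    by apply: ler_pM; rewrite ?tail_le ?c_le.
  by rewrite -mulrA mulrA -expr2 M2 ler_piMl.
have term_le i j : i != j -> (i + j < N)%N ->
    B ^+ ((i + j) ^ 2).+1 * (`|c i| * `|c j|) <= D.
  move=> i_ne ij_lt; have [i_ge|i_lt] := leqP n i; first exact: far_le.
  have [j_ge|j_lt] := leqP n j.
    by rewrite addnC (mulrC `|c i|); apply: far_le; rewrite // addnC.
  apply: le_trans (_ : B ^+ (2 * i ^ 2 + 2 * j ^ 2) * (`|c i| * `|c j|) <= _).
    rewrite ler_wpM2r ?mulr_ge0 // ler_weXn2l //.
    by move: i_ne; rewrite neq_ltn => /orP[] ?; nia.
  by rewrite exprD mulrACA -M2 expr2 ler_pM ?d_le ?mulr_ge0 ?exprn_ge0 ?(ltW B_gt0).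
(* The form lies in the disk of center D and radius D, which is contained in
   the right half-plane. *)
suff : `|D - hankel_form (fun k => B ^+ (k ^ 2)) N c| <= D.
  set z := hankel_form _ _ _ => z_near.
  have := le_trans (leif_Re_Creal (D - z)) z_near.
  rewrite raddfB /= (Creal_ReP _ (ger0_real D_ge0)).
  by rewrite lerBlDr lerDl.
pose F i := `|B ^+ (2 * i ^ 2) * c i| ^+ 2.
have D_diag : D = \sum_(k < N) \sum_(i < k.+1)
    (if k == i.*2 :> nat then F i else 0) by rewrite sum_double_diag.
rewrite {1}D_diag /hankel_form -sumrB; apply: le_trans (ler_norm_sum _ _ _) _.
apply: (@le_trans _ _ (\sum_(k < N) N%:R * (D / B))); last first.
  rewrite sumr_const card_ord -[leLHS]mulr_natl mulrA -natrM mulnn.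
  by rewrite mulrC divfK ?gt_eqF.
apply: ler_sum => k _; rewrite mulr_sumr -sumrB.
apply: le_trans (ler_norm_sum _ _ _) _.
apply: (@le_trans _ _ (\sum_(i < k.+1) (D / B))); last first.
  rewrite sumr_const card_ord -[leLHS]mulr_natl ler_wpM2r ?divr_ge0 ?(ltW B_gt0) //.
  by rewrite ler_nat.
apply: ler_sum => i _; have i_le : (i <= k)%N by rewrite -ltnS.
move: (ltn_ord k) i_le; move: (nat_of_ord i) => {}i.
move: (nat_of_ord k) => {}k k_lt i_le.
case: eqP => [k_eq | k_ne].
  rewrite k_eq -addnn addnK /F normrM exprMn ger0_norm ?exprn_ge0 ?(ltW B_gt0) //.
  rewrite -normCK -exprM (_ : ((i + i) ^ 2 = 2 * i ^ 2 * 2)%N); last by nia.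
  by rewrite subrr normr0 divr_ge0 ?(ltW B_gt0).
rewrite sub0r normrN ler_pdivlMr // mulrC normrM.
rewrite (ger0_norm (exprn_ge0 _ (ltW B_gt0))) mulrA -exprS normrM norm_conjC.
rewrite -[in (k ^ 2)%N](subnKC i_le).
by apply: term_le; lia.
Qed.

(** Since [i + j <= 2 m + 1], an entry survives only if both indices are at least
    [m]: the entry [(m.+1, m.+1)], which would bound the form below, is cut off. *)
Lemma hankel_form_two_terms (K : numClosedFieldType) (m : nat) (a c : nat -> K) :
    (forall i, (i < m)%N -> c i = 0) ->
  hankel_form a m.+1.*2 c =
  a m.*2 * (c m * (c m)^*) +
  a m.*2.+1 * (c m * (c m.+1)^* + c m.+1 * (c m)^*).
Proof.
move=> c0.
have prod0 k i : (i < m)%N || (k - i < m)%N -> c i * (c (k - i)%N)^* = 0.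
  by move=> /orP[/c0->|/c0->]; rewrite ?mul0r // rmorph0 mulr0.
rewrite /hankel_form doubleS big_ord_recr big_ord_recr /= big1 ?add0r => [|k _].
  have lt0 : (m < m.*2.+1)%N by lia.
  have lt1 : (m < m.*2.+2)%N by lia.
  have lt2 : (m.+1 < m.*2.+2)%N by lia.
  congr (_ * _ + _ * _).
    rewrite (bigD1 (Ordinal lt0)) //= big1 ?addr0 => [|i].
      by rewrite -addnn addnK.
    by rewrite -val_eqE /= => i_ne; apply: prod0; have := ltn_ord i; lia.
  rewrite (bigD1 (Ordinal lt1)) //= (bigD1 (Ordinal lt2)) /=; last first.
    by rewrite -val_eqE /=; lia.
  rewrite big1 ?addr0 => [|i].
    have -> : (m.*2.+1 - m = m.+1)%N by lia.
    by have -> : (m.*2.+1 - m.+1 = m)%N by lia.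
  by rewrite -!val_eqE /= => i_ne; apply: prod0; have := ltn_ord i; lia.
rewrite big1 ?mulr0 // => i _; apply: prod0.
by have := ltn_ord i; have := ltn_ord k; lia.
Qed.

(** * Quadratic forms and the derivative along a segment *)

Section Adjoint.
Variable C : numClosedFieldType.

Lemma hermsymP n (A : 'M[C]_n) : reflect (A^t* = A) (A \is hermsymmx).
Proof.
by apply: (iffP (is_hermitianmxP _ _ _)); rewrite expr0 scale1r => /esym.
Qed.

Lemma adjmxM m n p (A : 'M[C]_(m, n)) (B : 'M[C]_(n, p)) :
  (A *m B)^t* = B^t* *m A^t*.
Proof. by rewrite trmx_mul map_mxM. Qed.

Lemma adjmxD m n (A B : 'M[C]_(m, n)) : (A + B)^t* = A^t* + B^t*.
Proof. by rewrite linearD /= map_mxD. Qed.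

Lemma adjmxZ m n (a : C) (A : 'M[C]_(m, n)) : (a *: A)^t* = a^* *: A^t*.
Proof. by rewrite linearZ /= map_mxZ. Qed.

Lemma adjmxX n (A : 'M[C]_n) k : (A ^+ k)^t* = (A^t*) ^+ k.
Proof.
elim: k => [|k IHk]; first by rewrite !expr0 trmx1 map_mx1.
by rewrite exprS exprSr -!mulmxE adjmxM IHk.
Qed.

Lemma hermsymD n (A B : 'M[C]_n) :
  A \is hermsymmx -> B \is hermsymmx -> A + B \is hermsymmx.
Proof.
move=> /hermsymP A_herm /hermsymP B_herm; apply/hermsymP.
by rewrite adjmxD A_herm B_herm.
Qed.

Lemma hermsymB n (A B : 'M[C]_n) :
  A \is hermsymmx -> B \is hermsymmx -> A - B \is hermsymmx.
Proof.
move=> /hermsymP A_herm /hermsymP B_herm; apply/hermsymP.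
by rewrite linearB /= map_mxB A_herm B_herm.
Qed.

Lemma unitary_diagX n (P : 'M[C]_n) (d : 'rV[C]_n) k : P \is unitarymx ->
  (invmx P *m diag_mx d *m P) ^+ k =
  invmx P *m diag_mx (map_mx (fun z => z ^+ k) d) *m P.
Proof.
move=> /unitarymx_unit Pu; elim: k => [|k IHk].
  rewrite expr0 (_ : map_mx _ _ = const_mx 1).
    by rewrite diag_const_mx mulmx1 mulVmx.
  by apply/matrixP => i j; rewrite !mxE.
rewrite exprS IHk -mulmxE !mulmxA mulmxK // -[X in X *m P]mulmxA mulmx_diag.
congr (_ *m diag_mx _ *m _); apply/matrixP => i j.
by rewrite !mxE ord1 exprS.
Qed.

Lemma quad_diag n (d : 'rV[C]_n) (w : 'cV[C]_n) :
  (w^t* *m diag_mx d *m w) 0 0 = \sum_m d 0 m * `|w m 0| ^+ 2.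
Proof.
rewrite mul_mx_diag mxE; apply: eq_bigr => m _.
by rewrite !mxE normCK; ring.
Qed.

(** Expanding [U U^*] over the columns [u] of [U] splits each term into
    [(w^* x^i u) (u^* x^(k-i) w)], whose second factor is the conjugate of
    [w^* x^(k-i) u] as [x] is self-adjoint. *)
Lemma hankel_form_gram (n r N : nat) (a : nat -> C) (x : 'M[C]_n)
    (U : 'M[C]_(n, r)) (w : 'cV[C]_n) : x \is hermsymmx ->
  \sum_(k < N) a k * \sum_(i < k.+1)
      (w^t* *m (x ^+ i *m (U *m U^t*) *m x ^+ (k - i)) *m w) 0 0 =
  \sum_m hankel_form a N (fun i => (w^t* *m x ^+ i *m U) 0 m).
Proof.
move=> /hermsymP x_herm; rewrite /hankel_form exchange_big /=.
apply: eq_bigr => k _; rewrite -mulr_sumr; congr (_ * _).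
rewrite exchange_big /=; apply: eq_bigr => i _.
transitivity ((w^t* *m x ^+ i *m U *m (w^t* *m x ^+ (k - i) *m U)^t*) 0 0).
  by rewrite !adjmxM trmxCK adjmxX x_herm !mulmxA.
by rewrite mxE; apply: eq_bigr => m _; rewrite !mxE.
Qed.

(** The segment [x + t h] as a matrix with polynomial entries, so that its powers
    can be differentiated formally. *)
Definition pencil n (x h : 'M[C]_n) : 'M[{poly C}]_n :=
  map_mx polyC x + 'X *: map_mx polyC h.

Lemma pencil_horner n (x h : 'M[C]_n) k (t : C) :
  map_mx (horner_eval t) (pencil x h ^+ k) = (x + t *: h) ^+ k.
Proof.
elim: k => [|k IHk]; first by rewrite !expr0 map_mx1.
rewrite !exprS -!mulmxE map_mxM IHk; congr (_ *m _).
by apply/matrixP => i j; rewrite !mxE /= horner_evalE !hornerE.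
Qed.

Lemma map_derivM m n p (A : 'M[{poly C}]_(m, n)) (B : 'M[{poly C}]_(n, p)) :
  map_mx deriv (A *m B) = map_mx deriv A *m B + A *m map_mx deriv B.
Proof.
apply/matrixP => i j; rewrite !mxE raddf_sum -big_split /=.
by apply: eq_bigr => k _; rewrite derivM !mxE.
Qed.

Lemma pencil_deriv n (x h : 'M[C]_n) k :
  map_mx deriv (pencil x h ^+ k.+1) =
  \sum_(i < k.+1) pencil x h ^+ i *m map_mx polyC h *m pencil x h ^+ (k - i).
Proof.
have d1 : map_mx deriv (pencil x h) = map_mx polyC h.
  by apply/matrixP => i j; rewrite !mxE /= !poly.derivE mul1r mulr0 addr0 add0r.
elim: k => [|k IHk].
  by rewrite big_ord1 expr1 expr0 mul1mx mulmx1.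
rewrite exprS -mulmxE map_derivM IHk d1 [RHS]big_ord_recl expr0 mul1mx subn0.
congr (_ + _); rewrite mulmx_sumr; apply: eq_bigr => i _ /=.
by rewrite exprS -mulmxE !mulmxA.
Qed.

End Adjoint.

Section LoewnerOrder.
Variable R : realType.
Local Notation C := R[i].

Lemma complex_ge0 (z : C) : z \is Num.real -> (0 <= z) = (0 <= complex.Re z).
Proof. by move=> /complex_realP[a ->]; rewrite ler0c. Qed.

Lemma ReB (u v : C) : complex.Re (u - v) = complex.Re u - complex.Re v.
Proof. by case: u v => [? ?] [? ?]. Qed.

Lemma Re_sum_ge0 (I : finType) (F : I -> C) :
  (forall i, 0 <= complex.Re (F i)) -> 0 <= complex.Re (\sum_i F i).
Proof. by move=> F_ge0; rewrite raddf_sum; apply: sumr_ge0 => i _; apply: F_ge0. Qed.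

Lemma Re_poly (q : {poly C}) : exists p : {poly R},
  (forall t, p.[t] = complex.Re q.[t%:C]) /\
  (forall t, p^`().[t] = complex.Re q^`().[t%:C]).
Proof.
have Re_hornerE (r : {poly C}) t : (map_poly (@complex.Re R) r).[t] = complex.Re r.[t%:C].
  rewrite (@horner_coef_wide _ (size r)) ?size_poly //.
  rewrite horner_coef raddf_sum; apply: eq_bigr => i _ /=.
  rewrite coef_map_id0 // -rmorphXn /=; case: (r`_i) => u v /=.
  by rewrite mulr0 subr0.
exists (map_poly (@complex.Re R) q); split=> // t.
rewrite -Re_hornerE; congr (_.[t]); apply/polyP => i.
by rewrite coef_deriv !coef_map_id0 // coef_deriv raddfMn.
Qed.

(** The real part of the quadratic form along a segment is a real polynomial, so
    the mean value theorem for polynomials applies to it. *)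
Lemma quad_deriv n (a : nat -> R) N (x h : 'M[C]_n) (w : 'cV[C]_n) :
  exists p : {poly R},
    (forall t, p.[t] = complex.Re (\sum_(k < N) (a k)%:C *
       (w^t* *m (x + t%:C *: h) ^+ k.+1 *m w) 0 0)) /\
    (forall t, p^`().[t] = complex.Re (\sum_(k < N) (a k)%:C *
       \sum_(i < k.+1) (w^t* *m ((x + t%:C *: h) ^+ i *m h *m
          (x + t%:C *: h) ^+ (k - i)) *m w) 0 0)).
Proof.
pose W := map_mx polyC w; pose W' := map_mx polyC (w^t* ).
pose q : {poly C} := \sum_(k < N) (a k)%:C *:
  (W' *m pencil x h ^+ k.+1 *m W) 0 0.
have evalW (t : C) : map_mx (horner_eval t) W = w.
  by apply/matrixP => i j; rewrite !mxE /= horner_evalE hornerC.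
have evalW' (t : C) : map_mx (horner_eval t) W' = (w^t* ).
  by apply/matrixP => i j; rewrite !mxE /= horner_evalE hornerC.
have evalH (t : C) : map_mx (horner_eval t) (map_mx polyC h) = h.
  by apply/matrixP => i j; rewrite !mxE /= horner_evalE hornerC.
have dC m l (A : 'M[C]_(m, l)) : map_mx deriv (map_mx polyC A) = 0.
  by apply/matrixP => i j; rewrite !mxE derivC.
have [p [pE dpE]] := Re_poly q.
have entryE m l (A : 'M[{poly C}]_(m, l)) i j (t : C) :
  (A i j).[t] = map_mx (horner_eval t) A i j by rewrite mxE /= horner_evalE.
exists p; split=> t; rewrite ?pE ?dpE; congr complex.Re.
  rewrite horner_sum; apply: eq_bigr => k _.
  by rewrite hornerZ entryE !map_mxM pencil_horner evalW evalW'.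
rewrite raddf_sum horner_sum; apply: eq_bigr => k _.
rewrite /= derivZ hornerZ; congr (_ * _).
have -> : ((W' *m pencil x h ^+ k.+1 *m W) 0 0)^`() =
    (W' *m map_mx deriv (pencil x h ^+ k.+1) *m W) 0 0.
  transitivity (map_mx deriv (W' *m pencil x h ^+ k.+1 *m W) 0 0).
    by rewrite [RHS]mxE.
  by rewrite !map_derivM !dC mul0mx add0r mulmx0 addr0.
rewrite pencil_deriv mulmx_sumr mulmx_suml summxE horner_sum.
apply: eq_bigr => i _.
by rewrite entryE !map_mxM !pencil_horner evalW evalW' evalH.
Qed.

Lemma poly_min_deriv_ge0 (p : {poly R}) (e : R) : 0 < e ->
  (forall t, 0 <= t <= e -> p.[0] <= p.[t]) -> 0 <= p^`().[0].
Proof.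
move=> e_gt0 p_min; rewrite leNgt; apply/negP => dp_lt0.
have dpN_gt0 : 0 < - p^`().[0] by rewrite oppr_gt0.
have [d d_gt0 dP] := poly_cont 0 p^`() dpN_gt0.
pose t := Num.min e (d / 2).
have t_gt0 : 0 < t by rewrite lt_min e_gt0 divr_gt0.
have [c] := poly_mvt p t_gt0; rewrite in_itv /= => /andP[c_gt0 c_lt] mvt.
have t_ge : p.[0] <= p.[t] by apply: p_min; rewrite ltW //= ge_min lexx.
have c_near : `|c - 0| < d.
  rewrite subr0 gtr0_norm //; apply: lt_le_trans c_lt _.
  by rewrite ge_min; apply/orP; right; rewrite ler_pdivrMr // ler_peMr ?ler1n ?ltW.
have dc_lt0 : p^`().[c] < 0.
  by have := le_lt_trans (ler_norm _) (dP c c_near); rewrite ltrBlDr addNr.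
by move: t_ge; rewrite -subr_ge0 mvt subr0 pmulr_lge0 // leNgt dc_lt0.
Qed.

(** * Spectra and the Loewner order *)

Lemma herm_quad_real n (A : 'M[C]_n) (w : 'cV[C]_n) :
  A \is hermsymmx -> (w^t* *m A *m w) 0 0 \is Num.real.
Proof.
move=> /hermsymP A_herm; apply/CrealP.
have /matrixP/(_ 0 0) : (w^t* *m A *m w)^t* = w^t* *m A *m w.
  by rewrite !adjmxM trmxCK A_herm mulmxA.
by rewrite !mxE.
Qed.

Lemma quad_sub n (A B : 'M[C]_n) (w : 'cV[C]_n) :
  (w^t* *m (A - B) *m w) 0 0 = (w^t* *m A *m w) 0 0 - (w^t* *m B *m w) 0 0.
Proof. by rewrite mulmxBr mulmxBl !mxE. Qed.

Lemma spectral_diag_Re n (x : 'M[C]_n) m : x \is hermsymmx ->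
  spectral_diag x 0 m = (complex.Re (spectral_diag x 0 m))%:C.
Proof.
by move=> /hermitian_spectral_diag_real/mxOverP/(_ 0 m) d_real; rewrite RRe_real.
Qed.

Lemma herm_spectralE n (x : 'M[C]_n) : x \is hermsymmx ->
  x = invmx (spectralmx x) *m diag_mx (spectral_diag x) *m spectralmx x.
Proof. by move=> /hermitian_normalmx/orthomx_spectralP. Qed.

Lemma spectral_diag_eigenvalue n (x : 'M[C]_n) m : x \is hermsymmx ->
  eigenvalue x (spectral_diag x 0 m).
Proof.
move=> x_herm; set P := spectralmx x; set d := spectral_diag x.
have Pu : P \in unitmx by apply: spectral_unit.
apply/eigenvalueP; exists (row m P).
  rewrite -row_mul [X in P *m X]herm_spectralE // !mulmxA mulmxV // mul1mx.
  by rewrite mul_diag_mx; apply/rowP => j; rewrite !mxE.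
apply/eqP => /(congr1 (mulmx^~ (invmx P))); rewrite -row_mul mulmxV // mul0mx.
by move=> /rowP/(_ m); rewrite !mxE eqxx => /eqP; rewrite oner_eq0.
Qed.

Lemma quad_spectral n (x : 'M[C]_n) (w : 'cV[C]_n) : x \is hermsymmx ->
  (w^t* *m x *m w) 0 0 =
  \sum_m spectral_diag x 0 m * `|(spectralmx x *m w) m 0| ^+ 2.
Proof.
move=> x_herm; rewrite [in LHS](herm_spectralE x_herm) -quad_diag adjmxM.
by rewrite invmx_unitary ?spectral_unitarymx // !mulmxA.
Qed.

Lemma funcalc_herm n (f : R -> R) (x : 'M[C]_n) : funcalc f x \is hermsymmx.
Proof.
apply/hermsymP; rewrite /funcalc invmx_unitary ?spectral_unitarymx //.
rewrite !adjmxM trmxCK mulmxA tr_diag_mx map_diag_mx; congr (_ *m diag_mx _ *m _).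
by apply/matrixP => i j; rewrite !mxE; apply/CrealP/complex_realP; eexists.
Qed.

Lemma funcalc_quad n (a : nat -> R) N (x : 'M[C]_n) (w : 'cV[C]_n) :
    x \is hermsymmx ->
  (w^t* *m funcalc (fun t => \sum_(k < N) a k * t ^+ k.+1) x *m w) 0 0 =
  \sum_(k < N) (a k)%:C * (w^t* *m x ^+ k.+1 *m w) 0 0.
Proof.
move=> x_herm; rewrite /funcalc.
set P := spectralmx x; set d := spectral_diag x; pose f t : R := \sum_(k < N) a k * t ^+ k.+1.
have -> : diag_mx (map_mx (fun z : C => (f (complex.Re z))%:C) d) =
    \sum_(k < N) (a k)%:C *: diag_mx (map_mx (fun z => z ^+ k.+1) d).
  apply/matrixP => i j; rewrite summxE !mxE.
  under eq_bigr do rewrite !mxE mulrnAr.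
  rewrite sumrMnl; congr (_ *+ _); rewrite /f rmorph_sum /=.
  by apply: eq_bigr => k _; rewrite /d [in RHS]spectral_diag_Re // rmorphM rmorphXn.
rewrite mulmx_sumr mulmx_suml mulmx_sumr mulmx_suml summxE.
apply: eq_bigr => k _.
rewrite [in RHS](herm_spectralE x_herm) unitary_diagX ?spectral_unitarymx //.
by rewrite -scalemxAr -scalemxAl -scalemxAr -scalemxAl mxE.
Qed.

Lemma psdmx_spectral_ge0 n (x : 'M[C]_n) m : psdmx x -> 0 <= spectral_diag x 0 m.
Proof.
case=> x_herm /(_ (invmx (spectralmx x) *m delta_mx m 0)).
rewrite quad_spectral // mulKVmx ?spectral_unit // (bigD1 m) //= big1 => [|k k_ne].
  by rewrite mxE !eqxx normr1 expr1n mulr1 addr0.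
by rewrite mxE (negPf k_ne) normr0 expr0n mulr0.
Qed.

Lemma psdmx_unitary_diag n (P : 'M[C]_n) (d : 'rV[C]_n) : P \is unitarymx ->
  (forall m, 0 <= d 0 m) -> psdmx (invmx P *m diag_mx d *m P).
Proof.
move=> Pu d_ge0; rewrite invmx_unitary //; split.
  have d_conj : map_mx Num.conj d = d.
    by apply/rowP => m; rewrite !mxE; apply/CrealP; rewrite ger0_real.
  apply/hermsymP; rewrite !adjmxM trmxCK mulmxA tr_diag_mx map_diag_mx.
  by rewrite d_conj.
move=> w; rewrite !mulmxA -adjmxM -mulmxA quad_diag.
by apply: sumr_ge0 => m _; rewrite mulr_ge0 ?exprn_ge0.
Qed.

Lemma psdmx_gram n r (U : 'M[C]_(n, r)) : psdmx (U *m U^t*).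
Proof.
split; first by apply/hermsymP; rewrite adjmxM trmxCK.
move=> w; have -> : w^t* *m (U *m U^t*) *m w = (w^t* *m U) *m (w^t* *m U)^t*.
  by rewrite adjmxM trmxCK !mulmxA.
by rewrite mxE; apply: sumr_ge0 => m _; rewrite !mxE -normCK exprn_ge0.
Qed.

(** Scale an orthonormal eigenbasis by the square roots of the eigenvalues. *)
Lemma psdmx_gramP n (h : 'M[C]_n) : psdmx h -> exists U : 'M[C]_n, h = U *m U^t*.
Proof.
move=> h_psd; have [h_herm _] := h_psd; set P := spectralmx h.
pose s := map_mx sqrtC (spectral_diag h).
exists (P^t* *m diag_mx s); rewrite adjmxM trmxCK.
have -> : (diag_mx s)^t* = diag_mx s.
  rewrite tr_diag_mx map_diag_mx; congr diag_mx; apply/rowP => m.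
  by rewrite !mxE; apply/CrealP; rewrite ger0_real ?sqrtC_ge0 ?psdmx_spectral_ge0.
have ss : diag_mx s *m diag_mx s = diag_mx (spectral_diag h).
  rewrite mulmx_diag; congr diag_mx; apply/rowP => m.
  by rewrite !mxE -expr2 sqrtCK.
rewrite mulmxA -(mulmxA (P^t* )) ss -invmx_unitary ?spectral_unitarymx //.
exact: herm_spectralE.
Qed.

Lemma psdmxD n (x y : 'M[C]_n) : psdmx x -> psdmx y -> psdmx (x + y).
Proof.
move=> [/hermsymP x_herm x_ge0] [/hermsymP y_herm y_ge0]; split.
  by apply/hermsymP; rewrite adjmxD x_herm y_herm.
by move=> w; rewrite mulmxDr mulmxDl mxE addr_ge0.
Qed.

Lemma psdmxZ n (a : R) (x : 'M[C]_n) : 0 <= a -> psdmx x -> psdmx (a%:C *: x).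
Proof.
move=> a_ge0 [/hermsymP x_herm x_ge0]; split.
  apply/hermsymP; rewrite adjmxZ x_herm; congr (_ *: _).
  by apply/CrealP/complex_realP; exists a.
by move=> w; rewrite -scalemxAr -scalemxAl mxE mulr_ge0 ?ler0c.
Qed.

Lemma loewner_le_trans n (x y z : 'M[C]_n) :
  loewner_le x y -> loewner_le y z -> loewner_le x z.
Proof. by move=> xy yz; have := psdmxD yz xy; rewrite addrA subrK. Qed.

Lemma scalar_spectralE n (P : 'M[C]_n) (c : C) : P \is unitarymx ->
  c%:M = invmx P *m diag_mx (const_mx c) *m P.
Proof.
move=> Pu; rewrite diag_const_mx mul_mx_scalar -scalemxAl.
by rewrite mulVmx ?unitarymx_unit ?scalemx1.
Qed.

Lemma spectral_scalar_loewner n (x : 'M[C]_n) (a : R) : x \is hermsymmx ->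
  (forall m, a%:C <= spectral_diag x 0 m) -> loewner_le (a%:C)%:M x.
Proof.
move=> x_herm d_ge; rewrite /loewner_le (herm_spectralE x_herm).
rewrite (scalar_spectralE _ (spectral_unitarymx x)) -mulmxBl -mulmxBr -raddfB.
apply: psdmx_unitary_diag => [|m]; first exact: spectral_unitarymx.
by rewrite !mxE subr_ge0.
Qed.

Lemma spectral_loewner_scalar n (x : 'M[C]_n) (b : R) : x \is hermsymmx ->
  (forall m, spectral_diag x 0 m <= b%:C) -> loewner_le x (b%:C)%:M.
Proof.
move=> x_herm d_le; rewrite /loewner_le [X in _ - X](herm_spectralE x_herm).
rewrite (scalar_spectralE _ (spectral_unitarymx x)) -mulmxBl -mulmxBr -raddfB.
apply: psdmx_unitary_diag => [|m]; first exact: spectral_unitarymx.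
by rewrite !mxE subr_ge0.
Qed.

Lemma loewner_le_scalar n (h : 'M[C]_n) : h \is hermsymmx ->
  exists2 b : R, 0 < b & loewner_le h (b%:C)%:M.
Proof.
move=> h_herm; pose r m := complex.Re (spectral_diag h 0 m).
pose b : R := 1 + \sum_m `|r m|.
exists b; first by rewrite ltr_wpDr // sumr_ge0.
apply: spectral_loewner_scalar => // m; rewrite spectral_diag_Re // lecR.
apply: le_trans (ler_norm _) _; rewrite /b (bigD1 m) //= addrCA lerDl.
by rewrite addr_ge0 // sumr_ge0.
Qed.

Lemma loewner_diag n (s t : 'rV[C]_n) :
  (forall m, s 0 m <= t 0 m) -> loewner_le (diag_mx s) (diag_mx t).
Proof.
move=> st; rewrite /loewner_le -raddfB /=.
rewrite (_ : diag_mx _ = invmx 1%:M *m diag_mx (t - s) *m 1%:M); last first.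
  by rewrite invmx1 mul1mx mulmx1.
apply: psdmx_unitary_diag => [|m]; last by rewrite !mxE subr_ge0.
by apply/unitarymxP; rewrite trmx1 map_mx1 mulmx1.
Qed.

Lemma eigenvalues_loewner n (x : 'M[C]_n) (a b : R) : x \is hermsymmx ->
  eigenvalues_in `[a, b] x -> loewner_le (a%:C)%:M x /\ loewner_le x (b%:C)%:M.
Proof.
move=> x_herm x_ab.
have d_ab m : a%:C <= spectral_diag x 0 m <= b%:C.
  have [r] := x_ab _ (spectral_diag_eigenvalue m x_herm).
  by rewrite /= in_itv /= => r_ab ->; rewrite !lecR.
split; [apply: spectral_scalar_loewner|apply: spectral_loewner_scalar] => // m.
  by case/andP: (d_ab m).
by case/andP: (d_ab m).
Qed.

(** Evaluate both inequalities on an eigenvector; an eigenvalue above a real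
    number is itself real. *)
Lemma loewner_eigenvalues n (x : 'M[C]_n) (a b : R) :
  loewner_le (a%:C)%:M x -> loewner_le x (b%:C)%:M -> eigenvalues_in `[a, b] x.
Proof.
move=> [_ ax] [_ xb] l /eigenvalueP[v vx v_neq0].
pose S : C := \sum_m `|v 0 m| ^+ 2.
have S_gt0 : 0 < S.
  rewrite lt_def sumr_ge0 ?andbT => [|m _]; last exact: exprn_ge0.
  apply: contra v_neq0 => /eqP S0; apply/eqP/rowP => m; rewrite mxE.
  apply/eqP; suff: `|v 0 m| ^+ 2 == 0 by rewrite sqrf_eq0 normr_eq0.
  apply/eqP; apply: (psumr_eq0P _ S0) => // k _; rewrite exprn_ge0.
have vv : (v *m v^t* ) 0 0 = S.
  by rewrite mxE; apply: eq_bigr => m _; rewrite !mxE normCK.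
have quadE (c : C) : (v *m (x - c%:M) *m v^t* ) 0 0 = (l - c) * S.
  by rewrite mulmxBr vx mul_mx_scalar -scalerBl -scalemxAl mxE vv.
have := ax (v^t* ); rewrite trmxCK quadE pmulr_lge0 // subr_ge0 => al.
have := xb (v^t* ); rewrite trmxCK -opprB mulmxN mulNmx mxE quadE.
rewrite oppr_ge0 pmulr_lle0 // subr_le0 => lb.
have l_real : l \is Num.real by rewrite -(ler_real al); apply/complex_realP; exists a.
exists (complex.Re l); last by rewrite RRe_real.
by rewrite /= in_itv /= -!lecR RRe_real // al lb.
Qed.

Lemma eigenvalues_in_sub n (I J : set R) (x : 'M[C]_n) :
  I `<=` J -> eigenvalues_in I x -> eigenvalues_in J x.
Proof. by move=> IJ x_I l /x_I[r /IJ]; exists r. Qed.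

Lemma eigenvalues_in_loewner n (x y z : 'M[C]_n) (a b : R) :
    x \is hermsymmx -> z \is hermsymmx ->
    eigenvalues_in `[a, b] x -> eigenvalues_in `[a, b] z ->
  loewner_le x y -> loewner_le y z -> eigenvalues_in `[a, b] y.
Proof.
move=> x_herm z_herm /(eigenvalues_loewner x_herm)[ax _].
move=> /(eigenvalues_loewner z_herm)[_ zb] xy yz.
exact: loewner_eigenvalues (loewner_le_trans ax xy) (loewner_le_trans yz zb).
Qed.

(** * The function, and its monotonicity of order n *)

(** The quadratic exponent makes the Hankel matrix of these coefficients, suitably
    rescaled, close to the identity. *)
Definition gap_coef n (k : nat) : R := ((n.*2 ^ 2)%:R : R) ^+ (k ^ 2).

Definition gap_fun n (t : R) : R := \sum_(k < n.*2) gap_coef n k * t ^+ k.+1.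

(** With [N = n.*2] and [B = N ^ 2], the first factor is [B] times the bound
    [B ^ (N ^ 2)] for the coefficients; the second is the constant of
    [power_sum_tail_le]. *)
Definition gap_radius n : R :=
  (((n.*2 ^ 2)%:R : R) ^+ ((n.*2) ^ 2).+1 * (n%:R * 2 ^+ n))^-1.

Lemma continuous_gap_fun n : continuous (gap_fun n).
Proof.
pose p := \sum_(k < n.*2) gap_coef n k *: 'X^(k.+1).
have -> : gap_fun n = horner p.
  apply/funext => t; rewrite horner_sum; apply: eq_bigr => k _.
  by rewrite hornerZ hornerXn.
exact: continuous_horner.
Qed.

Lemma gap_radius_gt0 n : (0 < n)%N -> 0 < gap_radius n.
Proof.
move=> n_gt0; rewrite invr_gt0 !mulr_gt0 ?exprn_gt0 ?ltr0n //.
by rewrite expn_gt0 double_gt0 n_gt0.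
Qed.

Lemma gap_fun_quad n q (x : 'M[C]_q) (w : 'cV[C]_q) : x \is hermsymmx ->
  (w^t* *m funcalc (gap_fun n) x *m w) 0 0 =
  \sum_(k < n.*2) (gap_coef n k)%:C * (w^t* *m x ^+ k.+1 *m w) 0 0.
Proof. exact: funcalc_quad. Qed.

Lemma gap_fun_derivative_ge0 n r (x : 'M[C]_n) (U : 'M[C]_(n, r)) (w : 'cV[C]_n) :
    (0 < n)%N -> x \is hermsymmx -> eigenvalues_in `[0, gap_radius n] x ->
  0 <= complex.Re (\sum_(k < n.*2) (gap_coef n k)%:C * \sum_(i < k.+1)
      (w^t* *m (x ^+ i *m (U *m U^t* ) *m x ^+ (k - i)) *m w) 0 0).
Proof.
move=> n_gt0 x_herm x_small.
rewrite (hankel_form_gram _ (fun k => (gap_coef n k)%:C)) //.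
apply: Re_sum_ge0 => m; rewrite -ler0c complexRe.
pose a : C := (gap_radius n)%:C.
set P := spectralmx x; set d := spectral_diag x.
(* In the eigenbasis of x the moments w^* x^i u are power sums of the
   eigenvalues d with weights b. *)
pose b l := (w^t* *m invmx P) 0 l * (P *m U) l m.
have cE i : (w^t* *m x ^+ i *m U) 0 m = \sum_l d 0 l ^+ i * b l.
  rewrite [in LHS](herm_spectralE x_herm) unitary_diagX ?spectral_unitarymx //.
  rewrite !mulmxA -[_ *m P *m U]mulmxA mul_mx_diag mxE.
  apply: eq_bigr => l _; rewrite [X in X * _ = _]mxE [map_mx _ _ _ _]mxE /b.
  by rewrite mulrA [_ * d 0 l ^+ i]mulrC.
set B : C := (n.*2 ^ 2)%:R.
have B_gt0 : 0 < B by rewrite ltr0n expn_gt0 double_gt0 n_gt0.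
have K_gt0 : 0 < n%:R * 2 ^+ n :> C by rewrite mulr_gt0 ?exprn_gt0 ?ltr0n.
have aE : a = (B ^+ (n.*2 ^ 2).+1 * (n%:R * 2 ^+ n))^-1.
  rewrite /a /gap_radius fmorphV rmorphM [X in _ * X]rmorphM.
  by rewrite !rmorphXn !rmorph_nat.
have B_ge1 : 1 <= B ^+ (n.*2 ^ 2).+1.
  by rewrite exprn_ege1 // ler1n expn_gt0 double_gt0 n_gt0.
have aBK : B ^+ (n.*2 ^ 2).+1 * (n%:R * 2 ^+ n * a) = 1.
  by rewrite mulrA aE divff // mulf_neq0 ?gt_eqF ?exprn_gt0.
have a_ge0 : 0 <= a by rewrite ler0c ltW ?gap_radius_gt0.
pose c i := \sum_l d 0 l ^+ i * b l.
have -> : hankel_form (fun k => (gap_coef n k)%:C) n.*2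
    (fun i => (w^t* *m x ^+ i *m U) 0 m) =
    hankel_form (fun k => B ^+ (k ^ 2)) n.*2 c.
  apply: eq_bigr => k _; rewrite /gap_coef rmorphXn rmorph_nat; congr (_ * _).
  by apply: eq_bigr => i _; rewrite !cE.
apply: (@hankel_form_Re_ge0 C n c (n%:R * 2 ^+ n * a)) => //.
- by rewrite mulr_ge0 // ltW.
- by rewrite aBK.
move=> M c_le; apply: power_sum_tail_le => //.
  by rewrite -[leRHS]aBK ler_peMl // mulr_ge0 // ltW.
move=> l; have [t] := x_small _ (spectral_diag_eigenvalue l x_herm).
rewrite /= in_itv /= => /andP[t_ge0 t_le]; rewrite -/d => ->.
by rewrite ger0_norm ?ler0c // lecR.
Qed.

(** The segment from [x] to [y] stays in the order interval between them, so the
    spectrum stays in [[0, gap_radius n]] and the derivative stays nonnegative. *)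
Lemma gap_fun_monotone n : (0 < n)%N ->
  matrix_monotone n `[0, gap_radius n[ (gap_fun n).
Proof.
move=> n_gt0; split; first exact/continuous_subspaceT/continuous_gap_fun.
have sub : `[0, gap_radius n[ `<=` `[0, gap_radius n].
  by move=> t; rewrite /= !in_itv /= => /andP[-> /ltW].
move=> x y x_herm y_herm /(eigenvalues_in_sub sub) x_in.
move=> /(eigenvalues_in_sub sub) y_in xy.
have f_herm : funcalc (gap_fun n) y - funcalc (gap_fun n) x \is hermsymmx.
  by apply: hermsymB; apply: funcalc_herm.
split=> // w; rewrite complex_ge0 ?herm_quad_real // quad_sub.
rewrite [X in X - _](gap_fun_quad n w y_herm) [X in _ - X](gap_fun_quad n w x_herm).
have [U hE] := psdmx_gramP xy.
have [p [pE dpE]] := quad_deriv (gap_coef n) n.*2 x (y - x) w.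
have p0 := pE 0; have p1 := pE 1.
rewrite scale0r addr0 in p0; rewrite scale1r [x + _]addrC subrK in p1.
rewrite ReB -[X in X - _]p1 -[X in _ - X]p0 subr_ge0.
apply: (@ler_hornerW _ 0 1); rewrite ?in_itv /= ?ler01 ?lexx // => t.
rewrite in_itv /= => /andP[t_gt0 t_lt1].
pose z := x + t%:C *: (y - x).
have z_ge : loewner_le x z.
  by rewrite /loewner_le addrC addKr; apply: psdmxZ xy; exact: ltW.
have z_le : loewner_le z y.
  have : psdmx ((1 - t)%:C *: (y - x)) by apply: psdmxZ xy; rewrite subr_ge0 ltW.
  by rewrite rmorphB rmorph1 scalerBl scale1r /loewner_le /z opprD addrA.
have z_herm : z \is hermsymmx.
  exact: hermsymD x_herm (psdmxZ (ltW t_gt0) xy).1.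
have z_in := eigenvalues_in_loewner x_herm y_herm x_in y_in z_ge z_le.
have := gap_fun_derivative_ge0 U w n_gt0 z_herm z_in.
by rewrite -hE dpE.
Qed.

(** * Failure of order n + 1 on every interval *)

(** Take [x] diagonal with [n + 1] distinct eigenvalues in the lower part of an
    interval contained in [J], and a rank-one [h = U U^*] for which the Hankel
    form is negative.  Then [w^* g(x + e h) w] decreases for small [e], while the
    spectrum of [x + e h] has not yet left the interval. *)
Lemma gap_fun_not_monotone n (J : set R) : (0 < n)%N -> nontrivial_interval J ->
  ~ matrix_monotone n.+1 J (gap_fun n).
Proof.
case: n => // m _ [J_itv J_pts] [_ mono].
have [s1 [s2 [Js1 Js2 s12]]] : exists s1 s2, [/\ J s1, J s2 & s1 < s2].
  have [s1 [s2 [Js1 Js2 /eqP]]] := J_pts.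
  by rewrite neq_lt => /orP[]; [exists s1, s2|exists s2, s1].
have sub : `[s1, s2] `<=` J.
  by move=> t; rewrite /= in_itv /=; apply: J_itv.
(* The m + 2 points s1 + l * r start at s1 and stop at s2 - 2 * r, which leaves
   room for a perturbation of norm at most r. *)
pose r := (s2 - s1) / m.+3%:R.
have r_gt0 : 0 < r by rewrite divr_gt0 ?subr_gt0.
have s2E : s2 = s1 + m.+3%:R * r.
  by rewrite /r mulrC divfK ?pnatr_eq0 // addrC subrK.
pose t (l : 'I_m.+2) : C := (s1 + l%:R * r)%:C.
have t_inj : injective t.
  move=> l l' /eqP; rewrite (inj_eq (@complexI R)) (inj_eq (addrI _)).
  rewrite (inj_eq (mulIf (lt0r_neq0 r_gt0))) eqr_nat => /eqP; exact: val_inj.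
pose a k : R := gap_coef m.+1 k.
have a_gt0 k : 0 < a k by rewrite exprn_gt0 // ltr0n.
(* The prescribed power sums are 0, ..., 0, 1, q, and the form takes the value
   a_(2m) + 2 q a_(2m+1); this q turns it into - a_(2m). *)
pose q : R := - (a m.*2 / a m.*2.+1).
pose b k : C := if (k < m)%N then 0 else if k == m then 1 else q%:C.
have [u uE] := power_sums_prescribed b t_inj.
pose x : 'M[C]_m.+2 := diag_mx (\row_l t l).
pose w : 'cV[C]_m.+2 := const_mx 1.
pose U : 'cV[C]_m.+2 := \col_l u l.
have x_herm : x \is hermsymmx.
  apply/hermsymP; rewrite tr_diag_mx map_diag_mx; congr diag_mx.
  by apply/rowP => l; rewrite !mxE; apply/CrealP/complex_realP; eexists.
have xX k : x ^+ k = diag_mx (\row_l t l ^+ k).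
  elim: k => [|k IHk].
    by apply/matrixP => i j; rewrite !mxE.
  rewrite exprS IHk -mulmxE mulmx_diag; congr diag_mx.
  by apply/rowP => l; rewrite !mxE exprS.
have cE k : (w^t* *m x ^+ k *m U) 0 0 = \sum_l t l ^+ k * u l.
  rewrite xX mul_mx_diag mxE; apply: eq_bigr => l _.
  by rewrite !mxE rmorph1 mul1r.
pose h := U *m U^t*; have h_psd : psdmx h := psdmx_gram U.
(* As h <= d, the perturbation e * h is at most r for all e <= r / d. *)
have [d d_gt0 h_le] := loewner_le_scalar h_psd.1.
have [p [pE dpE]] := quad_deriv a m.+1.*2 x h w.
have dp0 : p^`().[0] = - a m.*2.
  rewrite dpE scale0r addr0 (hankel_form_gram _ (fun k => (a k)%:C)) //.
  rewrite big_ord1 (hankel_form_two_terms (m := m)); last first.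
    by move=> i i_lt; rewrite cE uE ?(ltn_trans i_lt) // /b i_lt.
  rewrite !cE !uE // /b ltnn eqxx ltnNge leqnSn /= gtn_eqF //.
  rewrite rmorph1 !mulr1 mul1r.
  rewrite (@conj_Creal _ q%:C); last by apply/complex_realP; exists q.
  rewrite -!rmorphD -rmorphM -rmorphD /= /q.
  by field; rewrite gt_eqF.
suff : 0 <= p^`().[0] by rewrite dp0 oppr_ge0 leNgt a_gt0.
apply: (poly_min_deriv_ge0 (e := r / d)); first exact: divr_gt0.
move=> e /andP[e_ge0 e_le]; pose y := x + e%:C *: h.
have eh_psd : psdmx (e%:C *: h) by apply: psdmxZ.
have xy : loewner_le x y by rewrite /loewner_le /y addrC addKr.
have y_herm : y \is hermsymmx := hermsymD x_herm eh_psd.1.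
have s1x : loewner_le (s1%:C)%:M x.
  rewrite -diag_const_mx; apply: loewner_diag => l.
  by rewrite !mxE lecR lerDl mulr_ge0 // ltW.
have x_up : loewner_le x ((s2 - r)%:C)%:M.
  rewrite -diag_const_mx; apply: loewner_diag => l.
  rewrite !mxE lecR s2E -addrA lerD2l -[X in _ <= _ - X]mul1r -mulrBl.
  rewrite ler_wpM2r ?(ltW r_gt0) // -[1]/(1%:R) -natrB // ler_nat.
  by have := ltn_ord l; lia.
have eh_up : loewner_le (e%:C *: h) (r%:C)%:M.
  have := psdmxZ e_ge0 h_le; rewrite scalerBr scale_scalar_mx -rmorphM => eh_ed.
  apply: loewner_le_trans eh_ed _; rewrite -!diag_const_mx.
  by apply: loewner_diag => l; rewrite !mxE lecR -ler_pdivlMr.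
have y_s2 : loewner_le y (s2%:C)%:M.
  have := psdmxD x_up eh_up.
  by rewrite addrACA -opprD -raddfD -rmorphD subrK.
have x_in : eigenvalues_in J x.
  have := loewner_eigenvalues s1x (loewner_le_trans xy y_s2).
  exact: eigenvalues_in_sub.
have y_in : eigenvalues_in J y.
  have := loewner_eigenvalues (loewner_le_trans s1x xy) y_s2.
  exact: eigenvalues_in_sub.
have [_ /(_ w)] := mono x y x_herm y_herm x_in y_in xy.
rewrite quad_sub [X in X - _](gap_fun_quad m.+1 w y_herm).
rewrite [X in _ - X](gap_fun_quad m.+1 w x_herm).
have p0 := pE 0; rewrite scale0r addr0 in p0.
rewrite lecE => /andP[_]; rewrite ReB -[X in X - _](pE e) -[X in _ - X]p0.
by rewrite subr_ge0.
Qed.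

End LoewnerOrder.

Theorem theorem2 (R : realType) (n : nat) (n_ge1 : (1 <= n)%N) :
  exists (alpha : R) (g : R -> R),
    [/\ 0 < alpha,
        matrix_monotone n `[0, alpha[ g,
        ~ matrix_monotone n.+1 `[0, alpha[ g
      & forall J : set R, nontrivial_interval J -> J `<=` `[0, alpha[ ->
          ~ matrix_monotone n.+1 J g].
Proof.
have alpha_gt0 := gap_radius_gt0 R n_ge1.
exists (gap_radius R n), (@gap_fun R n); split.
- exact: alpha_gt0.
- exact: gap_fun_monotone.
- apply: gap_fun_not_monotone => //; split; first exact: interval_is_interval.
  exists 0, (gap_radius R n / 2); rewrite /= !in_itv /= lexx alpha_gt0.
  rewrite divr_ge0 ?(ltW alpha_gt0) // ltr_pdivrMr // ltr_pMr // ltr1n.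
  by split=> //; apply/eqP; rewrite lt_eqF // divr_gt0.
by move=> J J_itv _; apply: gap_fun_not_monotone.
Qed.
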